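(* Let $m,n,p\ge1$ be integers. For each $l\in[m]$ let $X^{(l)}_1,\dots,X^{(l)}_n$ be independent random vectors in $\mathbb{R}^p$ with mean zero and covariance matrix $\Sigma^{(l)}$, such that every coordinate satisfies $\|X^{(l)}_{k,i}\|_{\psi_2}\le1$ for $i\in[p]$, $k\in[n]$, $l\in[m]$, and assume the $m$ samples are mutually independent across $l$. Let $\hat\Sigma^{(l)}=\frac1n\sum_{k=1}^nX^{(l)}_kX^{(l)\top}_k$. Then there exist absolute constants $C_1,C_2>0$ such that for all $i,j\in[p]$ and all $t>0$, $$\Pr\Big[\sum_{l=1}^m(\hat\Sigma^{(l)}_{ij}-\Sigma^{(l)}_{ij})^2\ge t+C_1\frac mn\Big]\le4\exp\Big(-C_2\min\Big\{\frac{n^2t^2}{m},nt,n\sqrt t\Big\}\Big);$$ equivalently, there is an absolute constant $C>0$ such that for every $\nu>0$, with probability at least $1-e^{-\nu}$, $$\sum_{l=1}^m(\hat\Sigma^{(l)}_{ij}-\Sigma^{(l)}_{ij})^2\le C\Big(\frac{m+\sqrt{m\nu}+\nu}{n}+\frac{\nu^2}{n^2}\Big).$$ Moreover, if there exists $c>0$ such that $\Pr[|\hat\Sigma^{(l)}_{ij}-\Sigma^{(l)}_{ij}|\ge t]\ge\exp(-c\min\{nt,nt^2\})$ for all $t>0$ (and all $l\in[m]$), then there exist constants $C_3,C_4,C_5>0$ (depending only on $c$) such that for all $t>0$, $$\Pr\Big[\sum_{l=1}^m(\hat\Sigma^{(l)}_{ij}-\Sigma^{(l)}_{ij})^2\ge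 t+C_3\frac mn\Big]\ge\frac1{C_4}\exp\Big(-C_5\min\Big\{\frac{n^2t^2}{m},nt,n\sqrt t\Big\}\Big).$$
   Context: For a random variable $X$, $\|X\|_{\psi_2}=\inf\{\eta>0:\mathbb{E}[\exp(X^2/\eta^2)-1]\le1\}$. $X^{(l)}_{k,i}$ denotes the $i$-th coordinate of $X^{(l)}_k$, and $[N]=\{1,\dots,N\}$. *)

(* Defs.v *)
From HB Require Import structures.
From mathcomp Require Import all_boot all_order all_algebra.
From mathcomp Require Import all_classical all_reals all_analysis.
Set Implicit Arguments. Unset Strict Implicit. Unset Printing Implicit Defensive.
Import Order.TTheory GRing.Theory Num.Theory.
Import numFieldNormedType.Exports.
Local Open Scope classical_set_scope.
Local Open Scope ring_scope.

Section defs.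
Context {d : measure_display} {T : measurableType d} {R : realType}
  (P : probability T R).

Definition sigma_vec (p : nat) (Y : 'I_p -> {RV P >-> R}) : set (set T) :=
  <<s \bigcup_(i in [set: 'I_p]) preimage_set_system setT (Y i) measurable >>.

(* mutual independence of a finite family of random vectors:
   the generated sigma-algebras are mutually independent
   (product rule for one event from each; taking setT for some indices
   gives the product rule for every subfamily) *)
Definition mutually_independent_vectors (I : finType) (p : nat)
  (Y : I -> 'I_p -> {RV P >-> R}) : Prop :=
  forall A : I -> set T, (forall a, sigma_vec (Y a) (A a)) ->
    P (\bigcap_(a in [set: I]) A a) = (\prod_(a : I) P (A a))%E.

Definition psi2_norm (X : {RV P >-> R}) : \bar R :=
  ereal_inf [set eta%:E | eta in
    [set eta : R | 0 < eta /\
       ('E_P[(fun w => expR (X w ^+ 2 / eta ^+ 2) - 1)%R] <= 1)%E]].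

Definition hatSigma (n p : nat) (Xl : 'I_n -> 'I_p -> {RV P >-> R})
  (i j : 'I_p) : T -> R :=
  fun w => n%:R^-1 * \sum_(k < n) Xl k i w * Xl k j w.

Definition sq_dev (m n p : nat) (X : 'I_m -> 'I_n -> 'I_p -> {RV P >-> R})
  (Sigma : 'I_m -> 'M[R]_p) (i j : 'I_p) : T -> R :=
  fun w => \sum_(l < m) (hatSigma (X l) i j w - Sigma l i j) ^+ 2.

Definition thm4_setting (m n p : nat)
  (X : 'I_m -> 'I_n -> 'I_p -> {RV P >-> R}) (Sigma : 'I_m -> 'M[R]_p) : Prop :=
  (0 < m)%N /\ (0 < n)%N /\ (0 < p)%N /\
  mutually_independent_vectors (fun lk : 'I_m * 'I_n => X lk.1 lk.2) /\
  (forall l k i, ('E_P[X l k i] = 0)%E) /\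
  (forall l k i j, covariance P (X l k i) (X l k j) = (Sigma l i j)%:E) /\
  (forall l k i, (psi2_norm (X l k i) <= 1)%E).

End defs.

(* Main.v *)
(** Write [D l] for the deviation of the [l]-th sample covariance.  The entries
    [X_i X_j] are subexponential, so independence gives a Gaussian bound on the
    joint moment generating function of [(n D l)_l] near the origin.  This is the
    only consequence of independence that is used: below the truncation level
    [B = q^2 (m/n + t)], [exp (lam n x^2)] is dominated by a finite positive
    combination of exponentials [exp (th n x)], and so is the indicator of
    [x^2 >= B].  Hence the Chernoff bound for the truncated sum and the union
    bound for [exists l, (D l)^2 > B] both reduce to that moment generating
    function.  Because the threshold contains a multiple of [m/n], the level [B]
    absorbs the factor [m] of the union bound, and the rate
    [n min (t, sqrt t)] holds without the term [n^2 t^2 / m].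

    For the lower bound with [C3] small, a single coordinate reaches [2 t] with
    the required probability when [n t > C3 m]; otherwise the number of [l] with
    [n (D l)^2 >= 1] has mean at least [exp(-c) m] and is at most [m], so it is
    proportional to [m] with probability bounded below. *)
Require Import Defs.
From HB Require Import structures.
From mathcomp Require Import all_boot all_order all_algebra.
From mathcomp Require Import all_classical all_reals all_analysis.
From mathcomp Require Import measurable_realfun ring lra zify.
Import Order.TTheory GRing.Theory Num.Theory.
Import numFieldNormedType.Exports.
Local Open Scope classical_set_scope.
Local Open Scope ring_scope.

(** * The rate function and mixtures of exponentials *)

Section rate.
Context {R : realType}.
Implicit Types s t b q : R.

(** Times [n], this is the part [min (n t) (n sqrt t)] of the exponent. The three-term minimum never
    exceeds it, so an upper tail at this rate is the stronger one. *)
Definition rate t : R := Num.min t (Num.sqrt t).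

Lemma rate_ge0 t : 0 <= t -> 0 <= rate t.
Proof. by move=> t0; rewrite /rate le_min t0 sqrtr_ge0. Qed.

Lemma rate_gt0 t : 0 < t -> 0 < rate t.
Proof. by move=> t0; rewrite /rate lt_min t0 sqrtr_gt0. Qed.

Lemma le_rate s t : s <= t -> rate s <= rate t.
Proof.
move=> st; rewrite /rate le_min !ge_min st /= ler_wsqrtr ?orbT //.
Qed.

(** The slope [rate s / s = min 1 (1 / sqrt s)] is nonincreasing; clearing denominators also covers
    [s = 0]. *)
Lemma rate_slope s b : 0 <= s -> s <= b -> rate b * s <= rate s * b.
Proof.
move=> s0 sb; have b0 : 0 <= b by exact: le_trans sb.
have us0 := sqrtr_ge0 s; have ub0 := sqrtr_ge0 b.
have usb : Num.sqrt s <= Num.sqrt b by rewrite ler_wsqrtr.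
have sE := sqr_sqrtr s0; have bE := sqr_sqrtr b0.
rewrite {2}/rate; case: (lerP s (Num.sqrt s)) => _.
  by rewrite mulrC ler_wpM2l // /rate ge_min lexx.
apply: (@le_trans _ _ (Num.sqrt b * s)).
  by rewrite ler_wpM2r // /rate ge_min lexx orbT.
move: us0 ub0 usb sE bE; move: (Num.sqrt s) (Num.sqrt b) => u v u0 v0 uv sE bE.
rewrite -sE -bE !expr2 mulrA (mulrA u v v) [u * v]mulrC ler_wpM2l //.
exact: mulr_ge0.
Qed.

(** Raising a level by [q ^+ 2] gains a factor [q] in the exponent: the root branch scales by
    exactly [q], the linear one by [q ^+ 2 >= q]. *)
Lemma rate_scale q t : 1 <= q -> 0 <= t -> q * rate t <= rate (q ^+ 2 * t).
Proof.
move=> q1 t0; have q0 : 0 <= q by lra.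
rewrite {2}/rate le_min sqrtrM ?sqr_ge0 // sqrtr_sqr ger0_norm //.
apply/andP; split; last by rewrite ler_wpM2l // /rate ge_min lexx orbT.
apply: (@le_trans _ _ (q * t)); first by rewrite ler_wpM2l // /rate ge_min lexx.
by rewrite ler_wpM2r // expr2 ler_peMl.
Qed.

Lemma rate_double t : 0 <= t -> rate (2 * t) <= 2 * rate t.
Proof.
move=> t0.
have := @rate_slope t (2 * t) t0 ltac:(lra).
have [->|tn0] := eqVneq t 0; first by rewrite /rate mulr0 sqrtr0 minxx mulr0.
have {}t0 : 0 < t by rewrite lt_def tn0 t0.
by rewrite mulrA ler_pM2r // [rate t * 2]mulrC.
Qed.

End rate.

Section mixture.
Context {R : realType}.
Implicit Types (s t b q x y K : R) (g : seq (R * R)).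

(** At level [k / n] the two branches are [k] and [sqrt (k n)]. With [k = m] this pays for the union
    bound; with [k = j.+1] it makes the sum over levels converge. *)
Lemma sqrt_le_rate (k n : nat) t : (0 < k)%N -> (0 < n)%N -> 0 <= t ->
  Num.sqrt k%:R <= n%:R * rate (k%:R / n%:R + t).
Proof.
move=> k0 n0 t0.
have k1 : 1 <= k%:R :> R by rewrite ler1n.
have n1 : 1 <= n%:R :> R by rewrite ler1n.
have nn : n%:R != 0 :> R by rewrite pnatr_eq0 -lt0n.
have sk : Num.sqrt k%:R <= k%:R :> R.
  have u1 : 1 <= Num.sqrt k%:R :> R by rewrite -[leLHS]sqrtr1 ler_wsqrtr.
  by rewrite -{2}(sqr_sqrtr (ler0n R k)) expr2 ler_peMl ?sqrtr_ge0 // u1.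
apply: (@le_trans _ _ (n%:R * rate (k%:R / n%:R))); last first.
  by rewrite ler_wpM2l // le_rate // lerDl.
rewrite /rate; case: (lerP (k%:R / n%:R)) => _; first by rewrite mulrCA divff ?mulr1.
rewrite sqrtrM // sqrtrV // mulrCA ler_peMr ?sqrtr_ge0 //.
rewrite -{1}(sqr_sqrtr (ler0n R n)) expr2 -mulrA divff ?mulr1; last first.
  by rewrite gt_eqF // sqrtr_gt0; lra.
by rewrite -[leLHS]sqrtr1 ler_wsqrtr.
Qed.

(* A list of pairs [(a, th)] stands for the mixture
   [\sum a * expR (th * x)]; [mix_bound K] bounds its mean when [expR (th * x)]
   has mean at most [expR (K * th ^+ 2)]. *)
Definition mix g x : R := \sum_(p <- g) p.1 * expR (p.2 * x).

Definition mix_bound K g : R := \sum_(p <- g) p.1 * expR (K * p.2 ^+ 2).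

Definition mix_ok (h : R) g := all (fun p => (0 <= p.1) && (`|p.2| <= h)) g.

Lemma mix_ge0 h g x : mix_ok h g -> 0 <= mix g x.
Proof.
move=> /allP gh; rewrite /mix big_seq; apply: sumr_ge0 => p /gh /andP[p0 _].
by rewrite mulr_ge0 ?expR_ge0.
Qed.

(* Evaluated at [n%:R * x], dominates the indicator of [s <= x ^+ 2]. *)
Definition tail_mix (kap : R) (n : nat) s : seq (R * R) :=
  let mu := kap * Num.min 1 (Num.sqrt s) in
  [:: (expR (- (mu * (n%:R * Num.sqrt s))), mu);
      (expR (- (mu * (n%:R * Num.sqrt s))), - mu)].

Lemma tail_mix_ok kap n s : 0 <= kap -> mix_ok kap (tail_mix kap n s).
Proof.
move=> k0; rewrite /mix_ok /= !expR_ge0 /= normrN andbT andbb.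
rewrite normrM (ger0_norm k0) ger0_norm ?le_min ?sqrtr_ge0 ?ler01//.
by rewrite ler_piMr // ge_min lexx.
Qed.

Lemma tail_mix_ge1 kap n s x : 0 <= kap -> 0 <= s -> s <= x ^+ 2 ->
  1 <= mix (tail_mix kap n s) (n%:R * x).
Proof.
move=> k0 s0 sx; rewrite /mix big_cons big_seq1 /=.
set mu := kap * _.
have mu0 : 0 <= mu by rewrite mulr_ge0 // le_min sqrtr_ge0 ler01.
have sx' : Num.sqrt s <= `|x| by rewrite -sqrtr_sqr ler_wsqrtr.
have n0 := ler0n R n.
rewrite -!expRD.
have [x0|x0] := lerP 0 x.
  rewrite -[leLHS]addr0 lerD ?expR_ge0 // -[leLHS]expR0 ler_expR addrC subr_ge0.
  by rewrite !ler_wpM2l //; rewrite ger0_norm in sx'.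
rewrite -[leLHS]add0r lerD ?expR_ge0 // -[leLHS]expR0 ler_expR addrC subr_ge0.
rewrite mulNr -mulrN -mulrN !ler_wpM2l //.
by rewrite ltr0_norm in sx'.
Qed.

(** The tilt [mu] is the Gaussian optimum [sqrt s / (2 K)] capped at [(2 K)^-1]. With [v = sqrt s]
    and [w = min 1 v] the exponent is [n w (w - 2 v) / (4 K)], at most [- n w v / (4 K)] because
    [w <= v], and [w v = rate s]. *)
Lemma tail_mix_bound K n s : 0 < K -> 0 <= s ->
  mix_bound (K * n%:R) (tail_mix (2 * K)^-1 n s) <=
  2 * expR (- ((4 * K)^-1 * (n%:R * rate s))).
Proof.
move=> K0 s0; rewrite /mix_bound big_cons big_seq1 /= sqrrN.
rewrite -mulr2n -[leLHS]mulr_natl ler_pM2l // -expRD ler_expR.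
set v := Num.sqrt s; set w := Num.min 1 v.
have v0 : 0 <= v by exact: sqrtr_ge0.
have -> : rate s = w * v.
  by rewrite /w minr_pMl // mul1r -expr2 sqr_sqrtr // /rate minC.
have w0 : 0 <= w by rewrite le_min v0 ler01.
have wv : w <= v by rewrite ge_min lexx orbT.
have -> : - ((2 * K)^-1 * w * (n%:R * v)) + K * n%:R * ((2 * K)^-1 * w) ^+ 2 =
   (4 * K)^-1 * (n%:R * w * (w - 2 * v)) by field; rewrite gt_eqF.
have k4 : 0 <= (4 * K)^-1 by rewrite invr_ge0 mulr_ge0 // ltW.
rewrite -[leRHS]mulrN ler_wpM2l // -subr_ge0.
have -> : - (n%:R * (w * v)) - n%:R * w * (w - 2 * v) = n%:R * w * (v - w).
  by ring.
by rewrite !mulr_ge0 // subr_ge0.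
Qed.

(* Evaluated at [n%:R * x], dominates [expR (lam * (n%:R * x ^+ 2))] as long as
   [n%:R * x ^+ 2 < J.+1%:R]: the increments of the exponential between
   consecutive integers are weighted by the corresponding tail mixtures. *)
Definition level_mix (kap lam : R) (n J : nat) : seq (R * R) :=
  (expR lam, 0) ::
  [seq ((expR lam - 1) * expR (lam * j.+1%:R) * p.1, p.2) |
     j <- index_iota 0 J, p <- tail_mix kap n (j.+1%:R / n%:R)].

Lemma expR_telescope (lam : R) (J : nat) :
  expR (lam * J.+1%:R) =
  expR lam + \sum_(0 <= j < J) (expR lam - 1) * expR (lam * j.+1%:R).
Proof.
elim: J => [|J IH]; first by rewrite mulr1 big_geq ?addr0.
rewrite big_nat_recr //= addrA -IH.
by rewrite -[in LHS]natr1 mulrDr mulr1 expRD; ring.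
Qed.

Lemma level_mix_ok kap lam n J : 0 <= kap -> 0 <= lam ->
  mix_ok kap (level_mix kap lam n J).
Proof.
move=> k0 l0; apply/allP => q.
rewrite /level_mix in_cons => /predU1P[->|]; first by rewrite /= expR_ge0 normr0.
move=> /allpairsPdep[j [p [_ pin ->]]] /=.
have /allP/(_ _ pin)/andP[p1 ->] := tail_mix_ok kap n (j.+1%:R / n%:R) k0.
by rewrite !mulr_ge0 ?expR_ge0 // subr_ge0 -expR0 ler_expR.
Qed.

Lemma level_mixE kap lam n J x : mix (level_mix kap lam n J) x =
  expR lam + \sum_(0 <= j < J) (expR lam - 1) * expR (lam * j.+1%:R) *
    mix (tail_mix kap n (j.+1%:R / n%:R)) x.
Proof.
rewrite /mix /level_mix big_cons; congr (_ + _).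
  by rewrite /= mul0r expR0 mulr1.
rewrite big_allpairs_dep; apply: eq_bigr => j _.
by rewrite mulr_sumr; apply: eq_bigr => p _; rewrite /= mulrA.
Qed.

Lemma level_mix_boundE K kap lam n J : mix_bound K (level_mix kap lam n J) =
  expR lam + \sum_(0 <= j < J) (expR lam - 1) * expR (lam * j.+1%:R) *
    mix_bound K (tail_mix kap n (j.+1%:R / n%:R)).
Proof.
rewrite /mix_bound /level_mix big_cons; congr (_ + _).
  by rewrite /= expr0n mulr0 expR0 mulr1.
rewrite big_allpairs_dep; apply: eq_bigr => j _.
by rewrite mulr_sumr; apply: eq_bigr => p _; rewrite /= mulrA.
Qed.

Lemma level_mix_ge kap lam n J x : 0 <= kap -> 0 <= lam -> (0 < n)%N ->
  n%:R * x ^+ 2 < J.+1%:R ->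
  expR (lam * (n%:R * x ^+ 2)) <= mix (level_mix kap lam n J) (n%:R * x).
Proof.
move=> k0 l0 n0 xJ; have n0' : 0 < n%:R :> R by rewrite ltr0n.
have z0 : 0 <= n%:R * x ^+ 2 by rewrite mulr_ge0 ?sqr_ge0 ?ler0n.
(* With [j0] the integer part of [n x^2], every level [j < j0] has [j.+1 <= n x^2], so its tail
   mixture is at least 1; these levels alone telescope to [expR (lam * j0.+1%:R)]. *)
have [j0 j0z zj0] : exists2 j0, j0%:R <= n%:R * x ^+ 2 & n%:R * x ^+ 2 < j0.+1%:R.
  by have /truncn_itv/andP[] := z0; eexists; eauto.
have j0J : (j0 <= J)%N by rewrite -ltnS -(ltr_nat R); exact: le_lt_trans xJ.
have lam1 : 0 <= expR lam - 1 by rewrite subr_ge0 -expR0 ler_expR.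
apply: (@le_trans _ _ (expR (lam * j0.+1%:R))).
  by rewrite ler_expR ler_wpM2l // ltW.
rewrite expR_telescope level_mixE lerD2l (big_cat_nat (leq0n j0) j0J) //=.
rewrite -[leLHS]addr0 lerD //; last first.
  apply: sumr_ge0 => j _; rewrite !mulr_ge0 ?expR_ge0 //.
  by apply: mix_ge0; exact: tail_mix_ok.
rewrite !big_nat; apply: ler_sum => j /= jj0.
rewrite ler_peMr ?mulr_ge0 ?expR_ge0 // tail_mix_ge1 // ?divr_ge0 //.
by rewrite ler_pdivrMr // mulrC (le_trans _ j0z) // ler_nat; exact: jj0.
Qed.

(** Since [expR z >= z ^+ 4 / 24], the terms decay like the inverse square of [v = j.+1], and
    [1 / v^2 <= 2 (1 / v - 1 / (v + 1))] makes the sum telescope. *)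
Lemma sum_expR_sqrt_le (a : R) (J : nat) : 0 < a ->
  \sum_(0 <= j < J) expR (- (a * Num.sqrt j.+1%:R)) <= 96 / a ^+ 4.
Proof.
move=> a0; have a4 : 0 < a ^+ 4 by rewrite exprn_gt0.
have c0 : 0 <= 48 / a ^+ 4 by rewrite divr_ge0 // ltW.
apply: (@le_trans _ _ (48 / a ^+ 4 * (2 - J.+1%:R^-1))); last first.
  rewrite [leRHS](_ : _ = 48 / a ^+ 4 * 2); last by field; rewrite gt_eqF.
  by rewrite ler_wpM2l // gerBl invr_ge0.
elim: J => [|J IH].
  by rewrite big_geq // invr1 mulr_ge0 //; lra.
rewrite big_nat_recr //=; apply: le_trans (lerD IH (lexx _)) _.
rewrite -lerBrDl [leRHS](_ : _ = 48 / a ^+ 4 * (J.+1%:R^-1 - J.+2%:R^-1)); last first.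
  by rewrite -mulrBr; congr (_ * _); ring.
have J1 : 1 <= J.+1%:R :> R by rewrite ler1n.
have J2E : J.+2%:R = J.+1%:R + 1 :> R by rewrite natr1.
set u := Num.sqrt _; have u2 : u ^+ 2 = J.+1%:R by rewrite sqr_sqrtr.
have u1 : 1 <= u by rewrite -[leLHS]sqrtr1 ler_wsqrtr.
have au0 : 0 < a * u by rewrite mulr_gt0 //; lra.
have e4 : (a * u) ^+ 4 / 24 <= expR (a * u).
  have := expR_ge1Dxn 3 (ltW au0).
  rewrite (_ : 4`! = 24)%N //; lra.
rewrite expRN invf_ple ?posrE ?expR_gt0 //; last first.
  rewrite mulr_gt0 ?divr_gt0 // subr_gt0 ltf_pV2 ?posrE //; lra.
apply: le_trans e4.
have u4 : u ^+ 4 = J.+1%:R ^+ 2 by rewrite -u2 -exprM.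
rewrite exprMn u4 J2E.
set v := J.+1%:R; have v1 : 1 <= v by [].
have -> : (48 / a ^+ 4 * (v^-1 - (v + 1)^-1))^-1 = a ^+ 4 / 48 * (v * (v + 1)).
  by field; rewrite !gt_eqF //; lra.
have -> : a ^+ 4 * v ^+ 2 / 24 = a ^+ 4 / 48 * (2 * v ^+ 2) by field.
have c1 : 0 <= a ^+ 4 / 48 by rewrite divr_ge0 // ltW.
by rewrite ler_wpM2l //; nra.
Qed.

End mixture.

(** * Chernoff bound for sums of squares *)

Section chernoff.
Context {R : realType}.

(** By [rate_slope], this tilt keeps the growth [lam * j.+1%:R] at levels [s <= B] within half of
    the decay [(4 K)^-1 n (rate s)]; the other half is summable. The prefactor [expR lam - 1] makes
    the final exponent proportional to [lam], so a multiple of [m / n] in the threshold can offset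
    [m] such factors. *)
Lemma level_mix_bound_le (K B lam : R) (n J : nat) :
  0 < K -> 0 < B -> (0 < n)%N -> J%:R <= n%:R * B ->
  lam = (8 * K)^-1 * rate B / B ->
  mix_bound (K * n%:R) (level_mix (2 * K)^-1 lam n J) <=
  expR (lam * (1 + 192 * (8 * K) ^+ 4)).
Proof.
move=> K0 B0 n0 JB; have n0' : 0 < n%:R :> R by rewrite ltr0n.
set a := (8 * K)^-1 => lamE; have a0 : 0 < a by rewrite invr_gt0 mulr_gt0.
have lam0 : 0 < lam by rewrite lamE divr_gt0 // mulr_gt0 // rate_gt0.
have e0 : 0 <= expR lam - 1 by rewrite subr_ge0 -[leLHS]expR0 ler_expR ltW.
rewrite level_mix_boundE.
apply: (@le_trans _ _ (expR lam + (expR lam - 1) * (2 * (96 / a ^+ 4)))).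
  rewrite lerD2l.
  apply: (@le_trans _ _ ((expR lam - 1) *
      (2 * \sum_(0 <= j < J) expR (- (a * Num.sqrt j.+1%:R))))); last first.
    by rewrite ler_wpM2l // ler_wpM2l // sum_expR_sqrt_le.
  rewrite !mulr_sumr !big_nat; apply: ler_sum => j /= jJ.
  rewrite -mulrA ler_wpM2l //.
  set s := j.+1%:R / n%:R; have s0 : 0 <= s by rewrite divr_ge0.
  apply: (@le_trans _ _ (expR (lam * j.+1%:R) *
      (2 * expR (- ((4 * K)^-1 * (n%:R * rate s)))))).
    by rewrite ler_wpM2l ?expR_ge0 // tail_mix_bound.
  rewrite mulrCA ler_pM2l // -expRD ler_expR.
  have sB : s <= B.
    by rewrite ler_pdivrMr // mulrC (le_trans _ JB) // ler_nat.
  have sq : Num.sqrt j.+1%:R <= n%:R * rate s.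
    by have := sqrt_le_rate _ _ _ (ltn0Sn j) n0 (lexx (0 : R)); rewrite addr0.
  have lams : lam * j.+1%:R <= a * (n%:R * rate s).
    have -> : lam * j.+1%:R = a * n%:R * (rate B * s / B).
      by rewrite lamE /s; field; rewrite !gt_eqF.
    rewrite [leRHS]mulrA ler_wpM2l ?mulr_ge0 ?(ltW a0) //.
    by rewrite ler_pdivrMr // rate_slope.
  have -> : (4 * K)^-1 = 2 * a by rewrite /a; field; rewrite gt_eqF.
  have := ler_wpM2l (ltW a0) sq.
  lra.
have -> : 2 * (96 / a ^+ 4) = 192 * (8 * K) ^+ 4.
  by rewrite /a exprVn invrK mulrA -natrM.
set M := 192 * _; have M0 : 0 <= M by rewrite mulr_ge0 // exprn_ge0 // mulr_ge0 // ltW.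
have e1 : expR lam - 1 <= expR lam * lam.
  have := ler_wpM2l (expR_ge0 lam) (expR_ge1Dx (- lam)).
  by rewrite expRN divff ?gt_eqF ?expR_gt0 //; lra.
apply: (@le_trans _ _ (expR lam * (1 + lam * M))).
  by have := ler_wpM2r M0 e1; lra.
rewrite (mulrDr lam) mulr1 expRD ler_wpM2l ?expR_ge0 //.
exact: expR_ge1Dx.
Qed.

Context {d : measure_display} {T : measurableType d} (P : probability T R).
Context (m : nat) (Z : 'I_m -> T -> R).
Context (mZ : forall l, measurable_fun setT (Z l)) (K h : R).
Context (mgfZ : forall th : 'I_m -> R, (forall l, `|th l| <= h) ->
  (\int[P]_w (expR (\sum_l th l * Z l w))%:E <= (expR (K * \sum_l th l ^+ 2))%:E)%E).

Lemma measurable_mix (g : seq (R * R)) (f : T -> R) :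
  measurable_fun setT f -> measurable_fun setT (fun w => mix g (f w)).
Proof.
move=> mf; apply: measurable_sum => p.
apply: measurable_funM; first exact: measurable_cst.
apply: measurableT_comp; first exact: measurable_expR.
by apply: measurable_funM; first exact: measurable_cst.
Qed.

(** Expanding the product over all choices of one term per coordinate gives joint exponentials, each
    controlled by [mgfZ]; the bounds then factor back into a power. *)
Lemma integral_prod_mix (g : seq (R * R)) : mix_ok h g ->
  (\int[P]_w (\prod_l mix g (Z l w))%:E <= (mix_bound K g ^+ m)%:E)%E.
Proof.
move=> gh.
pose u (i : 'I_(size g)) := tnth (in_tuple g) i.
have uP i : (0 <= (u i).1) && (`|(u i).2| <= h).
  by move/allP: gh; apply; exact: mem_tnth.
under eq_integral => w _.
  under eq_bigr => l _ do rewrite /mix big_tnth.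
  rewrite bigA_distr_bigA /= -sumEFin.
  over.
rewrite ge0_integral_sum //; last 2 first.
- move=> f; apply/measurable_EFinP; apply: measurable_prod => l _ .
  apply: measurable_funM; first exact: measurable_cst.
  apply: measurableT_comp; first exact: measurable_expR.
  by apply: measurable_funM; first exact: measurable_cst.
- move=> f w _; rewrite lee_fin prodr_ge0 // => l _.
  by rewrite mulr_ge0 ?expR_ge0 //; case/andP: (uP (f l)).
have -> : mix_bound K g ^+ m =
    \sum_(f : {ffun 'I_m -> 'I_(size g)}) \prod_l ((u (f l)).1 * expR (K * (u (f l)).2 ^+ 2)).
  rewrite /mix_bound big_tnth -(bigA_distr_bigA (fun _ i => (u i).1 * expR (K * (u i).2 ^+ 2))).
  by rewrite prodr_const card_ord.
rewrite -sumEFin; apply: lee_sum => f _.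
have p0 : 0 <= \prod_l (u (f l)).1 by apply: prodr_ge0 => l _; case/andP: (uP (f l)).
under eq_integral => w _ do rewrite big_split /= -expR_sum EFinM.
rewrite ge0_integralZl //; last first.
  apply/measurable_EFinP; apply: measurableT_comp; first exact: measurable_expR.
  apply: measurable_sum => l.
  by apply: measurable_funM; first exact: measurable_cst.
rewrite big_split /= -expR_sum -mulr_sumr EFinM lee_wpmul2l ?lee_fin //.
by apply: mgfZ => l; case/andP: (uP (f l)).
Qed.

Lemma integral_mix (g : seq (R * R)) (l : 'I_m) : mix_ok h g -> 0 <= h ->
  (\int[P]_w (mix g (Z l w))%:E <= (mix_bound K g)%:E)%E.
Proof.
move=> gh h0.
pose u (i : 'I_(size g)) := tnth (in_tuple g) i.
have uP i : (0 <= (u i).1) && (`|(u i).2| <= h).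
  by move/allP: gh; apply; exact: mem_tnth.
under eq_integral => w _ do rewrite /mix big_tnth -sumEFin.
rewrite ge0_integral_sum //; last 2 first.
- move=> i; apply/measurable_EFinP.
  apply: measurable_funM; first exact: measurable_cst.
  apply: measurableT_comp; first exact: measurable_expR.
  by apply: measurable_funM; first exact: measurable_cst.
- move=> i w _; rewrite lee_fin.
  by rewrite mulr_ge0 ?expR_ge0 //; case/andP: (uP i).
rewrite [mix_bound K g]big_tnth -sumEFin; apply: lee_sum => i _.
case/andP: (uP i) => u1 u2.
under eq_integral => w _ do rewrite EFinM.
rewrite ge0_integralZl //; last first.
  apply/measurable_EFinP; apply: measurableT_comp; first exact: measurable_expR.
  by apply: measurable_funM; first exact: measurable_cst.
rewrite EFinM lee_wpmul2l ?lee_fin //.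
(* A tilt vector supported at [l] reduces the joint hypothesis to one coordinate. *)
pose th l' := if l' == l then (u i).2 else 0.
have thE (y : 'I_m -> R) : \sum_l' th l' * y l' = (u i).2 * y l.
  rewrite (bigD1 l) //= /th eqxx big1 ?addr0 //.
  by move=> l' /negbTE->; rewrite mul0r.
have th2 : \sum_l' th l' ^+ 2 = (u i).2 ^+ 2.
  rewrite (bigD1 l) //= /th eqxx big1 ?addr0 //.
  by move=> l' /negbTE->; rewrite expr0n.
have thh l' : `|th l'| <= h by rewrite /th; case: ifP => // _; rewrite normr0.
rewrite -th2; apply: le_trans (mgfZ th thh); rewrite le_eqVlt; apply/orP; left.
by apply/eqP/eq_integral => w _; rewrite (thE (Z^~ w)).
Qed.

End chernoff.

Lemma le_integral_indic {R : realType} {d : measure_display}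
    {T : measurableType d} (P : probability T R) (A : set T) (f : T -> R) :
  measurable A -> measurable_fun setT f -> (forall w, 0 <= f w) ->
  (forall w, A w -> 1 <= f w) -> (P A <= \int[P]_w (f w)%:E)%E.
Proof.
move=> mA mf f0 f1; rewrite -(setIT A) -integral_indic //.
apply: ge0_le_integral => //.
- by apply/measurable_EFinP; exact: measurable_indic.
- by apply/measurable_EFinP.
- move=> w _; rewrite lee_fin indicE; have [wA|_] := boolP (w \in A) => //.
  by apply: f1; rewrite inE in wA.
Qed.

Section sum_sq.
Context {R : realType} {d : measure_display} {T : measurableType d}.
Context (P : probability T R) (m n : nat) (D : 'I_m -> T -> R) (K : R).
Context (K1 : 1 <= K) (m0 : (0 < m)%N) (n0 : (0 < n)%N).
Context (mD : forall l, measurable_fun setT (D l)).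
Context (mgfD : forall th : 'I_m -> R, (forall l, `|th l| <= (2 * K)^-1) ->
  (\int[P]_w (expR (\sum_l th l * (n%:R * D l w)))%:E <=
   (expR (K * n%:R * \sum_l th l ^+ 2))%:E)%E).

Lemma measurable_sum_sq : measurable_fun setT (fun w => \sum_l D l w ^+ 2).
Proof.
apply: measurable_sum => l.
by apply: measurable_funX; exact: mD.
Qed.

Lemma measurable_sum_sq_ge (x : R) :
  measurable [set w | x <= \sum_l D l w ^+ 2].
Proof.
rewrite [X in measurable X](_ : _ = setT `&` (fun w => \sum_l D l w ^+ 2) @^-1` `[x, +oo[).
  by apply: measurable_sum_sq => //; exact: measurable_itv.
by apply/seteqP; split => w /=; rewrite in_itv /= andbT => // -[].
Qed.

Lemma sum_sq_tail (t : R) : 0 < t ->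
  (P [set w | (t + (2 + 192 * (8 * K) ^+ 4) * (m%:R / n%:R) <=
               \sum_l D l w ^+ 2)%R]
   <= (3 * expR (- ((8 * K)^-1 / (12 * K) ^+ 2 * (n%:R * rate t))))%:E)%E.
Proof.
move=> t0; have K1' := K1; set M := 192 * _; set thr := t + _.
have K0 : 0 < K by exact: lt_le_trans K1.
have n0' : 0 < n%:R :> R by rewrite ltr0n.
have m0' : 0 < m%:R :> R by rewrite ltr0n.
(* This [q] gives [(4 K)^-1 * q = 3]: of three copies of [n * rate r] in the union bound, two absorb
   the factor [m] and one leaves the rate. *)
set q := 12 * K; have q1 : 1 <= q by rewrite /q; lra.
set r := m%:R / n%:R + t.
have mn0 : 0 < m%:R / n%:R :> R by rewrite divr_gt0.
have r0 : 0 < r by rewrite addr_gt0.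
pose B := q ^+ 2 * r; have B0 : 0 < B by rewrite mulr_gt0 // exprn_gt0 //; lra.
pose a := (8 * K)^-1; have a0 : 0 < a by rewrite invr_gt0 mulr_gt0.
pose lam := a * rate B / B.
have lam0 : 0 < lam by rewrite divr_gt0 // mulr_gt0 // rate_gt0.
(* The integer part ensures both that [x^2 < B] implies [n x^2 < J.+1] and that every level
   [j.+1 / n] with [j < J] is at most [B]. *)
pose J := Num.truncn (n%:R * B).
have nB0 : 0 <= n%:R * B by rewrite mulr_ge0 // ltW.
have /andP[JB BJ] := truncn_itv nB0; rewrite -/J in JB BJ.
pose h := (2 * K)^-1; have h0 : 0 <= h by rewrite invr_ge0 mulr_ge0 // ltW.
pose G := level_mix h lam n J.
pose g := tail_mix h n B.
have Gok : mix_ok h G by apply: level_mix_ok => //; exact: ltW.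
have gok : mix_ok h g by apply: tail_mix_ok.
pose Z l w := n%:R * D l w.
have mZ l : measurable_fun setT (Z l).
  by apply: measurable_funM; [exact: measurable_cst|exact: mD].
pose F1 w := \prod_l mix G (Z l w).
pose F2 w := \sum_l mix g (Z l w).
pose e := expR (- (lam * n%:R * thr)).
have mF1 : measurable_fun setT F1.
  by apply: measurable_prod => l _; apply: measurable_mix; exact: mZ.
have mF2 : measurable_fun setT F2.
  by apply: measurable_sum => l; apply: measurable_mix; exact: mZ.
have F1ge0 w : 0 <= F1 w by apply: prodr_ge0 => l _; exact: mix_ge0 Gok.
have F2ge0 w : 0 <= F2 w by apply: sumr_ge0 => l _; exact: mix_ge0 gok.
have e0 : 0 <= e by exact: expR_ge0.
(* If some square reaches [B], then [F2] alone is at least 1. Otherwise every square is below the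
   truncation level, and [F1] dominates the exponential of the whole sum, normalised by [e]. *)
have pointwise w : thr <= \sum_l D l w ^+ 2 -> 1 <= e * F1 w + F2 w.
  move=> thrw.
  have [/existsP[l Bl]|] := boolP [exists l, B <= D l w ^+ 2].
    rewrite -[leLHS]add0r lerD ?mulr_ge0 // /F2 (bigD1 l) //=.
    rewrite -[leLHS]addr0 lerD //.
      by apply: tail_mix_ge1 => //; exact: ltW.
    by apply: sumr_ge0 => l' _; exact: mix_ge0 gok.
  rewrite negb_exists => /forallP DB.
  rewrite -[leLHS]addr0 lerD //.
  apply: (@le_trans _ _ (e * expR (lam * (n%:R * \sum_l D l w ^+ 2)))).
    rewrite /e -expRD -[leLHS]expR0 ler_expR addrC subr_ge0 -mulrA.
    by rewrite ler_wpM2l ?(ltW lam0) // ler_wpM2l.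
  rewrite ler_wpM2l // !mulr_sumr expR_sum; apply: ler_prod => l _.
  rewrite expR_ge0 /=; apply: level_mix_ge => //; first exact: ltW.
  have := DB l; rewrite -ltNge => DlB.
  by apply: le_lt_trans BJ; rewrite ler_wpM2l // ltW.
apply: le_trans (le_integral_indic P _ (fun w => e * F1 w + F2 w)
  (measurable_sum_sq_ge thr) _ _ pointwise) _.
- by apply: measurable_funD => //; apply: measurable_funM.
- by move=> w; rewrite addr_ge0 // mulr_ge0.
have mE1 : measurable_fun setT (fun w => (F1 w)%:E) by exact/measurable_EFinP.
have mE2 : measurable_fun setT (fun w => (F2 w)%:E) by exact/measurable_EFinP.
have mg l : measurable_fun setT (fun w => (mix g (Z l w))%:E).
  by apply/measurable_EFinP; apply: measurable_mix; exact: mZ.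
have -> : (\int[P]_w (e * F1 w + F2 w)%:E = e%:E * \int[P]_w (F1 w)%:E +
    \sum_l \int[P]_w (mix g (Z l w))%:E)%E.
  under eq_integral => w _ do rewrite EFinD EFinM.
  have e0F w : [set: T] w -> (0 <= e%:E * (F1 w)%:E)%E.
    by move=> _; rewrite mule_ge0 // lee_fin.
  have F20 w : [set: T] w -> (0 <= (F2 w)%:E)%E by rewrite lee_fin.
  have F10 w : [set: T] w -> (0 <= (F1 w)%:E)%E by rewrite lee_fin.
  have g0 l w : [set: T] w -> (0 <= (mix g (Z l w))%:E)%E.
    by rewrite lee_fin => _; exact: mix_ge0 gok.
  have meF : measurable_fun setT (fun w => e%:E * (F1 w)%:E)%E by exact: measurable_funeM.
  rewrite (ge0_integralD P measurableT e0F meF F20 mE2).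
  rewrite (ge0_integralZl_EFin P measurableT F10 mE1 e0); congr (_ + _)%E.
  rewrite -(ge0_integral_sum P measurableT mg g0).
  by apply: eq_integral => w _; rewrite /F2 -sumEFin.
have I1 : (e%:E * \int[P]_w (F1 w)%:E <= (e * expR (lam * (1 + M)) ^+ m)%:E)%E.
  rewrite EFinM lee_wpmul2l //.
  apply: le_trans (integral_prod_mix P m Z mZ (K * n%:R) h mgfD G Gok) _.
  rewrite lee_fin lerXn2r ?nnegrE ?expR_ge0 //.
    by rewrite /mix_bound big_seq sumr_ge0 // => p /(allP Gok)/andP[? _]; rewrite mulr_ge0 ?expR_ge0.
  exact: (level_mix_bound_le K B lam n J K0 B0 n0 JB erefl).
have I2 : (\sum_l \int[P]_w (mix g (Z l w))%:E <=
    (m%:R * (2 * expR (- ((4 * K)^-1 * (n%:R * rate B)))))%:E)%E.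
  rewrite mulr_natl -[X in _ *+ X](card_ord m) -sumr_const -sumEFin.
  apply: lee_sum => l _.
  apply: le_trans (integral_mix P m Z mZ (K * n%:R) h mgfD g l gok h0) _.
  by rewrite lee_fin; apply: tail_mix_bound => //; exact: ltW.
apply: le_trans (leeD I1 I2) _; rewrite -EFinD lee_fin.
set N := n%:R * rate t.
have Nr : N <= n%:R * rate r by rewrite ler_wpM2l // le_rate // lerDr ltW.
have rB : q * (n%:R * rate r) <= n%:R * rate B.
  by rewrite mulrCA ler_wpM2l // rate_scale // ltW.
have sm : Num.sqrt m%:R <= n%:R * rate r by apply: sqrt_le_rate => //; exact: ltW.
have N0 : 0 <= N by rewrite mulr_ge0 // rate_ge0 // ltW.
have C2le : a / q ^+ 2 <= 1.
  rewrite ler_pdivrMr ?mul1r ?exprn_gt0 //; last by lra.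
  apply: (@le_trans _ _ 1); last by rewrite exprn_ege1.
  by rewrite /a invf_le1 ?mulr_gt0 //; lra.
have S1 : e * expR (lam * (1 + M)) ^+ m <= expR (- (a / q ^+ 2 * N)).
  rewrite /e -expRM_natl -expRD ler_expR.
  (* Of the [2 + M] copies of [m / n] in [thr], [1 + M] cancel the cost of the [m] mixtures. What
     remains is [r], and [lam n r = a n (rate B) / q^2]. *)
  have -> : - (lam * n%:R * thr) + m%:R * (lam * (1 + M)) = - (a / q ^+ 2 * (n%:R * rate B)).
    rewrite /lam /thr /B /r; field.
    by rewrite !gt_eqF ?addr_gt0 ?mulr_gt0 //; lra.
  rewrite lerN2 ler_wpM2l ?divr_ge0 ?exprn_ge0 ?(ltW a0) //; first lra.
  apply: le_trans Nr _; apply: le_trans rB.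
  by rewrite ler_peMl // mulr_ge0 // rate_ge0 // ltW.
have S2 : m%:R * (2 * expR (- ((4 * K)^-1 * (n%:R * rate B)))) <= 2 * expR (- (a / q ^+ 2 * N)).
  rewrite mulrCA ler_pM2l //.
  (* Both [sqrt m] and [N] are at most [n * rate r], and [m = (sqrt m)^2 <= expR (2 sqrt m)]. *)
  apply: (@le_trans _ _ (m%:R * (expR (- (2 * Num.sqrt m%:R)) * expR (- N)))).
    rewrite ler_wpM2l // -expRD ler_expR.
    have := ler_wpM2l (_ : 0 <= (4 * K)^-1) rB.
    rewrite (_ : (4 * K)^-1 * (q * (n%:R * rate r)) = 3 * (n%:R * rate r)); last first.
      by rewrite /q; field; rewrite gt_eqF.
    have k4 : 0 <= (4 * K)^-1 by rewrite invr_ge0 mulr_ge0 // ltW.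
    move=> /(_ k4); lra.
  rewrite mulrA; apply: (@le_trans _ _ (1 * expR (- N))).
    rewrite ler_wpM2r ?expR_ge0 // expRN ler_pdivrMr ?expR_gt0 // mul1r.
    rewrite expRM_natl -{1}(sqr_sqrtr (ler0n R m)).
    rewrite lerXn2r ?nnegrE ?sqrtr_ge0 ?expR_ge0 //.
    by apply: le_trans (expR_ge1Dx _); lra.
  rewrite mul1r ler_expR lerN2 -[leRHS]mul1r ler_wpM2r //.
by rewrite -/a -/q -/N; lra.
Qed.

End sum_sq.

(** * Expectation of a product of independent functions *)

Section independence.
Context {R : realType}.

(* [x] truncated at [N.+1%:R] and rounded down to a multiple of [N.+1%:R^-1],
   written with upper level sets so that the product rule for orthants applies. *)
Definition staircase (N : nat) (x : R) : R :=
  \sum_(k < N.+1 ^ 2) N.+1%:R^-1 * (k.+1%:R / N.+1%:R <= x)%R%:R.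

Lemma sum_nat_le (M : nat) (y : R) :
  \sum_(k < M) (k.+1%:R <= y)%R%:R = (minn M (Num.truncn y))%:R :> R.
Proof.
elim: M => [|M IH]; first by rewrite big_ord0 min0n.
rewrite big_ord_recr /= IH -truncn_gt_nat -natrD; congr (_%:R).
by case: (ltnP M (Num.truncn y)) => h; lia.
Qed.

Lemma staircaseE (N : nat) (x : R) :
  staircase N x = N.+1%:R^-1 * (minn (N.+1 ^ 2) (Num.truncn (N.+1%:R * x)))%:R.
Proof.
rewrite /staircase -mulr_sumr -sum_nat_le; congr (_ * _).
by apply: eq_bigr => k _; rewrite ler_pdivrMr // mulrC.
Qed.

Lemma staircase_ge0 (N : nat) (x : R) : 0 <= staircase N x.
Proof. by rewrite staircaseE mulr_ge0. Qed.

Lemma staircase_le (N : nat) (x : R) : 0 <= x -> staircase N x <= x.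
Proof.
move=> x0; rewrite staircaseE mulrC ler_pdivrMr // [leRHS]mulrC.
have y0 : 0 <= N.+1%:R * x by rewrite mulr_ge0.
have /andP[y1 _] := truncn_itv y0; apply: le_trans y1.
by rewrite ler_nat geq_minr.
Qed.

Lemma staircase_ge (N : nat) (x : R) : 0 <= x -> x <= N.+1%:R ->
  x - N.+1%:R^-1 <= staircase N x.
Proof.
move=> x0 xN; rewrite staircaseE.
have y0 : 0 <= N.+1%:R * x by rewrite mulr_ge0.
have /andP[y1 y2] := truncn_itv y0.
have yN : (Num.truncn (N.+1%:R * x) <= N.+1 ^ 2)%N.
  by rewrite -(ler_nat R); apply: le_trans y1 _; rewrite natrX expr2 ler_wpM2l.
rewrite (minn_idPr yN).
rewrite mulrC ler_pdivlMr // mulrBl mulVf ?pnatr_eq0 // mulrC.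
by move: y2; rewrite -natr1; lra.
Qed.

Lemma cvg_staircase (x : R) : 0 <= x -> staircase N x @[N --> \oo] --> x.
Proof.
move=> x0; apply: (@squeeze_cvgr _ _ _ _ (fun N => x - N.+1%:R^-1) (fun=> x)).
- near=> N; apply/andP; split; last exact: staircase_le.
  apply: staircase_ge => //.
  near: N; exists (Num.truncn x).+1 => // N /= xN.
  have /andP[_ /ltW xt] := truncn_itv x0.
  by rewrite (le_trans xt) // ler_nat ltnW // ltnS.
- rewrite -[X in _ --> X]subr0; apply: cvgB; first exact: cvg_cst.
  exact: (cvg_harmonic (R := R)).
- exact: cvg_cst.
Unshelve. all: by end_near. Qed.

Context {d : measure_display} {T : measurableType d} (P : probability T R).

(** Independence enters only through upper orthants. Staircases are finite nonnegative combinations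
    of indicators of upper level sets, so the mean of their product factors exactly. They converge
    from below but in general not monotonically in [N], hence the passage to the limit by Fatou. *)
Lemma integral_prod_le (I : finType) (f : I -> T -> R) (c : I -> R) :
  (forall a, measurable_fun setT (f a)) -> (forall a w, 0 <= f a w) ->
  (forall x : I -> R, P (\bigcap_(a in [set: I]) [set w | x a <= f a w]) =
                      (\prod_a P [set w | (x a <= f a w)%R])%E) ->
  (forall a, (\int[P]_w (f a w)%:E <= (c a)%:E)%E) ->
  (\int[P]_w (\prod_a f a w)%:E <= (\prod_a c a)%:E)%E.
Proof.
move=> mf f0 ind fc.
have mA a x : measurable [set w | x <= f a w].
  rewrite [X in measurable X](_ : _ = setT `&` f a @^-1` `[x, +oo[).
    by apply: mf => //; exact: measurable_itv.
  by apply/seteqP; split => w /=; rewrite in_itv /= andbT => // -[].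
pose g N w := (\prod_a staircase N (f a w))%:E.
have ms a N : measurable_fun setT (fun w => staircase N (f a w)).
  apply: measurable_sum => k; apply: measurable_funM; first exact: measurable_cst.
  rewrite (_ : (fun w => _) = \1_[set w | k.+1%:R / N.+1%:R <= f a w]).
    exact: measurable_indic.
  by apply/funext => w; rewrite indicE mem_setE.
have mg N : measurable_fun setT (g N).
  by apply/measurable_EFinP; apply: measurable_prod => a _.
have g0 N w : [set: T] w -> (0 <= g N w)%E.
  by move=> _; rewrite lee_fin prodr_ge0 // => a _; exact: staircase_ge0.
have gc N : (\int[P]_w g N w <= (\prod_a c a)%:E)%E.
  pose x (k : 'I_(N.+1 ^ 2)) : R := k.+1%:R / N.+1%:R.
  pose A a k := [set w | x k <= f a w].
  have sE a w : staircase N (f a w) = \sum_k N.+1%:R^-1 * \1_(A a k) w.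
    by apply: eq_bigr => k _; rewrite indicE mem_setE.
  pose p a k := fine (P (A a k)).
  have pE a k : P (A a k) = (p a k)%:E by rewrite fineK // fin_num_measure //; exact: mA.
  have Es a : (\int[P]_w (staircase N (f a w))%:E = (\sum_k N.+1%:R^-1 * p a k)%:E)%E.
    under eq_integral => w _ do rewrite sE -sumEFin.
    rewrite ge0_integral_sum //; last first.
      move=> k; apply/measurable_EFinP; apply: measurable_funM; first exact: measurable_cst.
      by apply: measurable_indic; exact: mA.
    rewrite -sumEFin; apply: eq_bigr => k _.
    under eq_integral => w _ do rewrite EFinM.
    rewrite ge0_integralZl_EFin //; last first.
      by apply/measurable_EFinP; apply: measurable_indic; exact: mA.
    rewrite integral_indic //; last exact: mA.
    by rewrite setIT EFinM; congr (_ * _)%E; exact: pE.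
  have -> : (\int[P]_w g N w = (\prod_a \sum_k N.+1%:R^-1 * p a k)%:E)%E.
    rewrite bigA_distr_bigA -sumEFin.
    rewrite /g; under eq_integral => w _.
      under eq_bigr => a _ do rewrite sE.
      rewrite bigA_distr_bigA -sumEFin; over.
    have mi (k : {ffun I -> 'I_(N.+1 ^ 2)}) : measurable (\bigcap_(a in [set: I]) A a (k a)).
      by apply: fin_bigcap_measurable => // a _; exact: mA.
    rewrite ge0_integral_sum //; last 2 first.
    - move=> k; apply/measurable_EFinP; apply: measurable_prod => a _.
      apply: measurable_funM; first exact: measurable_cst.
      by apply: measurable_indic; exact: mA.
    - by move=> k w _; rewrite lee_fin prodr_ge0 // => a _; rewrite mulr_ge0.
    apply: eq_bigr => k _.
    (* A product of indicators is the indicator of an orthant, to which [ind] applies. *)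
    have kE w : \prod_a (N.+1%:R^-1 * \1_(A a (k a)) w) =
        (\prod_(a : I) N.+1%:R^-1) * \1_(\bigcap_(a in [set: I]) A a (k a)) w :> R.
      rewrite big_split /=; congr (_ * _); rewrite indicE.
      have [/set_mem wA|wA] := boolP (w \in _).
        by rewrite big1 // => a _; rewrite indicE mem_set //; exact: wA.
      have [a wAa] : exists a, ~ A a (k a) w.
        apply/existsNP => wA'; move/negP: wA; apply; rewrite inE => a _; exact: wA'.
      by rewrite (bigD1 a) //= indicE memNset ?mul0r.
    under eq_integral => w _ do rewrite kE EFinM.
    rewrite ge0_integralZl_EFin //; last 2 first.
    - by apply/measurable_EFinP; apply: measurable_indic.
    - by rewrite prodr_ge0.
    rewrite integral_indic // setIT.
    transitivity ((\prod_(a : I) N.+1%:R^-1)%:E * \prod_a P (A a (k a)))%E.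
      by congr (_ * _)%E; exact: (ind (fun a => x (k a))).
    rewrite (eq_bigr (fun a => (p a (k a))%:E)) => [|a _]; last exact: pE.
    by rewrite prodEFin -EFinM -big_split.
  rewrite lee_fin; apply: ler_prod => a _; apply/andP; split.
    apply: sumr_ge0 => k _; rewrite mulr_ge0 // fine_ge0 //; exact: measure_ge0.
  rewrite -lee_fin -Es; apply: le_trans (fc a); apply: ge0_le_integral => //.
  - by move=> w _; rewrite lee_fin staircase_ge0.
  - by apply/measurable_EFinP.
  - by apply/measurable_EFinP.
  - by move=> w _; rewrite lee_fin staircase_le.
have gE w : limn_einf (g ^~ w) = (\prod_a f a w)%:E.
  suff : (g ^~ w) N @[N --> \oo] --> (\prod_a f a w)%:E.
    by move=> /cvg_limn_einf_sup[].
  apply: cvg_EFin; first exact: nearW.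
  rewrite /comp /g /=.
  elim: (index_enum I) => [|a s IH].
    rewrite big_nil; under eq_cvg do rewrite big_nil; exact: cvg_cst.
  rewrite big_cons; under eq_cvg do rewrite big_cons.
  by apply: cvgM => //; exact: cvg_staircase.
under eq_integral => w _ do rewrite -gE.
apply: le_trans (fatou P measurableT mg g0) _.
rewrite limn_einf_lim; apply: lime_le; first exact: is_cvg_einfs.
apply: nearW => N; apply: le_trans (gc N).
by apply: ereal_inf_lbound; exists N => /=.
Qed.

End independence.

(** * Moment generating functions *)

Section subexponential.
Context {R : realType}.

(** Everything follows from [expR x - 1 <= x * expR x]: it is applied twice when [x >= 0], and
    combined with [x * expR x <= x * (1 + x)] when [x < 0]. *)
Lemma expR_le_quad (x : R) : expR x <= 1 + x + x ^+ 2 * expR `|x|.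
Proof.
have e0 := expR_gt0 x.
have e1 : expR x - 1 <= x * expR x.
  have := ler_wpM2l (ltW e0) (expR_ge1Dx (- x)).
  by rewrite expRN divff ?gt_eqF //; lra.
have e2 := expR_ge1Dx x.
have [x0|x0] := lerP 0 x.
  rewrite ger0_norm //; have := ler_wpM2l x0 e1; lra.
rewrite ltr0_norm //.
have a1 : 1 <= expR (- x) by rewrite -[leLHS]expR0 ler_expR; lra.
have := ler_wpM2l (sqr_ge0 x) a1.
have xe : x * expR x <= x * (1 + x) by rewrite ler_wnM2l // ltW.
lra.
Qed.

(** The linear term is kept exact so that it can vanish in the mean. In the remainder,
    [w^2 <= 128 exp(|w|/8)] and [|th w| <= |w|/8] combine to [exp(|w|/4)], and shifting by [s] costs
    at most [expR 2]. *)
Lemma expR_centered_le (th v s : R) : `|th| <= 8^-1 -> `|s| <= 8 ->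
  expR (th * (v - s)) <=
  1 + th * (v - s) + 128 * expR 2 * th ^+ 2 * expR (`|v| / 4).
Proof.
move=> th8 s8; set w := v - s.
apply: le_trans (expR_le_quad _) _; rewrite lerD2l.
have w2 : w ^+ 2 <= 128 * expR (`|w| / 8).
  have w0 : 0 <= `|w| / 8 by rewrite divr_ge0.
  have := expR_ge1Dxn 1 w0.
  rewrite (_ : 2`! = 2)%N // expr_div_n real_normK ?num_real //; lra.
have wv : `|w| / 4 <= `|v| / 4 + 2.
  have := ler_normB v s; rewrite -/w; lra.
have tw : `|th * w| <= `|w| / 8.
  by rewrite normrM mulrC ler_wpM2l.
rewrite exprMn -[leLHS]mulrA.
apply: (@le_trans _ _ (th ^+ 2 * (128 * expR (`|w| / 8) * expR (`|w| / 8)))).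
  rewrite ler_wpM2l ?sqr_ge0 // ler_pM ?sqr_ge0 ?expR_ge0 // ler_expR //.
have -> : 128 * expR 2 * th ^+ 2 * expR (`|v| / 4) =
  th ^+ 2 * (128 * expR (`|v| / 4 + 2)) by rewrite (expRD _ 2); ring.
rewrite ler_wpM2l ?sqr_ge0 // -mulrA ler_pM2l // -expRD ler_expR; lra.
Qed.

Context {d : measure_display} {T : measurableType d} (P : probability T R).

Lemma integral_probability_cst (c : R) : (\int[P]_w c%:E = c%:E)%E.
Proof.
rewrite integral_cst // -[RHS]mule1; congr (_ * _)%E.
exact: probability_setT.
Qed.

(** The envelope [H], of mean at most 2, gives integrability of [V], the bound [|s| <= 4 * 2], and a
    quadratic remainder of mean at most [2 * 128 * expR 2 * th^2]; the linear term integrates to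
    zero. *)
Lemma mgf_centered_le (V H : T -> R) (s th : R) :
  measurable_fun setT V -> measurable_fun setT H ->
  (forall w, `|V w| <= 4 * H w) -> (forall w, expR (`|V w| / 4) <= H w) ->
  (\int[P]_w (H w)%:E <= 2%:E)%E -> (\int[P]_w (V w)%:E = s%:E)%E ->
  `|th| <= 8^-1 ->
  (\int[P]_w (expR (th * (V w - s)))%:E <= (expR (256 * expR 2 * th ^+ 2))%:E)%E.
Proof.
move=> mV mH VH eVH IH IV th8.
have mEV : measurable_fun setT (fun w => (V w)%:E) by exact/measurable_EFinP.
have mEH : measurable_fun setT (fun w => (H w)%:E) by exact/measurable_EFinP.
have H0 w : 0 <= H w by apply: le_trans (eVH w); exact: expR_ge0.
have iH : P.-integrable setT (fun w => (H w)%:E).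
  apply/integrableP; split => //.
  under eq_integral => w _ do rewrite gee0_abs ?lee_fin //.
  by apply: le_lt_trans IH _; rewrite ltry.
have iV : P.-integrable setT (fun w => (V w)%:E).
  apply: (le_integrable measurableT mEV) (integrableZl measurableT 4 iH) => w _ /=.
  by rewrite lee_fin (le_trans (VH w)) // ler_norm.
have s8 : `|s| <= 8.
  rewrite -lee_fin -abse_EFin -IV.
  apply: le_trans (le_abse_integral P measurableT mEV) _.
  apply: (@le_trans _ _ (\int[P]_w (4%:E * (H w)%:E))%E).
    apply: ge0_le_integral => //.
    - exact: measurableT_comp.
    - exact: measurable_funeM.
    - by move=> w _; rewrite -EFinM abse_EFin lee_fin.
  rewrite integralZl // (le_trans (lee_wpmul2l _ IH)) ?lee_fin //.
  by lra.
pose k := 128 * expR 2 * th ^+ 2.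
have k0 : 0 <= k by rewrite mulr_ge0 ?sqr_ge0 // mulr_ge0 ?expR_ge0.
pose U w := ((1 - th * s)%:E + k%:E * (H w)%:E)%E.
have i1 : P.-integrable setT (fun=> (1 - th * s)%:E).
  exact: finite_measure_integrable_cst.
have iU : P.-integrable setT U.
  by apply: integrableD => //; exact: integrableZl.
have iW : P.-integrable setT (fun w => th%:E * (V w)%:E)%E by exact: integrableZl.
apply: (@le_trans _ _ (\int[P]_w (th%:E * (V w)%:E + U w))%E).
  apply: ge0_le_integral => //.
  - apply/measurable_EFinP; apply: measurableT_comp; first exact: measurable_expR.
    apply: measurable_funM; first exact: measurable_cst.
    by apply: measurable_funB => //; exact: measurable_cst.
  - by apply: measurable_int (integrableD measurableT iW iU).
  - move=> w _; rewrite /U -!EFinM -!EFinD lee_fin.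
    apply: le_trans (expR_centered_le th (V w) s th8 s8) _.
    rewrite -/k; have := ler_wpM2l k0 (eVH w); lra.
rewrite integralD // integralZl // IV.
rewrite /U integralD //; last exact: integrableZl.
rewrite integralZl // integral_probability_cst.
apply: (@le_trans _ _ (th%:E * s%:E + ((1 - th * s)%:E + k%:E * 2%:E))%E).
  by rewrite !leeD2l // lee_wpmul2l ?lee_fin.
rewrite -!EFinM -!EFinD lee_fin.
by apply: le_trans (expR_ge1Dx _); rewrite /k; lra.
Qed.

(** An admissible [eta < 2] exists whether or not the infimum is attained; the denominator 4
    dominates its square. *)
Lemma psi2_norm_le1 (X : {RV P >-> R}) : (psi2_norm X <= 1)%E ->
  (\int[P]_w (expR (X w ^+ 2 / 4))%:E <= 2%:E)%E.
Proof.
move=> X1; have /ereal_inf_lt : (psi2_norm X < 2%:E)%E.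
  by apply: le_lt_trans X1 _; rewrite lte_fin ltr1n.
move=> [_ [eta [eta0 EX] <-]]; rewrite lte_fin => eta2.
rewrite unlock in EX.
have mX : measurable_fun setT (X : T -> R) by [].
have me c : measurable_fun setT (fun w => expR (X w ^+ 2 / c)).
  apply: measurableT_comp; first exact: measurable_expR.
  apply: measurable_funM; last exact: measurable_cst.
  by apply: measurable_funX.
have me1 c : measurable_fun setT (fun w => (expR (X w ^+ 2 / c) - 1)%:E).
  by apply/measurable_EFinP; apply: measurable_funB => //; exact: measurable_cst.
have ge1 c w : 0 <= c -> 0 <= expR (X w ^+ 2 / c) - 1.
  by move=> c0; rewrite subr_ge0 -[leLHS]expR0 ler_expR divr_ge0 ?sqr_ge0.
have E4 : (\int[P]_w (expR (X w ^+ 2 / 4) - 1)%:E <= 1)%E.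
  apply: le_trans EX; apply: ge0_le_integral => //.
  - by move=> w _; rewrite lee_fin ge1.
  - move=> w _; rewrite lee_fin lerD2r ler_expR ler_wpM2l ?sqr_ge0 //.
    rewrite lef_pV2 ?posrE ?exprn_gt0 //; nra.
under eq_integral => w _ do rewrite -[expR _](subrK 1) EFinD.
rewrite ge0_integralD //; last first.
  by move=> w _; rewrite lee_fin ge1.
rewrite integral_probability_cst.
by apply: le_trans (leeD2r _ E4) _; rewrite -EFinD lee_fin; lra.
Qed.

Lemma mgf_mul_le (X Y : {RV P >-> R}) (s th : R) :
  (psi2_norm X <= 1)%E -> (psi2_norm Y <= 1)%E ->
  (\int[P]_w (X w * Y w)%:E = s%:E)%E -> `|th| <= 8^-1 ->
  (\int[P]_w (expR (th * (X w * Y w - s)))%:E <= (expR (256 * expR 2 * th ^+ 2))%:E)%E.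
Proof.
move=> /psi2_norm_le1 X2 /psi2_norm_le1 Y2 IXY th8.
have mX : measurable_fun setT (X : T -> R) by [].
have mY : measurable_fun setT (Y : T -> R) by [].
have me (Z : T -> R) : measurable_fun setT Z ->
    measurable_fun setT (fun w => expR (Z w ^+ 2 / 4)).
  move=> mZ; apply: measurableT_comp; first exact: measurable_expR.
  apply: measurable_funM; last exact: measurable_cst.
  by apply: measurable_funX.
(* By the arithmetic-geometric inequality this average dominates [exp(|X Y|/4)], and its first-order
   expansion shows that [4 H] dominates [|X Y|]. *)
pose H w := 2^-1 * (expR (X w ^+ 2 / 4) + expR (Y w ^+ 2 / 4)).
have mH : measurable_fun setT H.
  apply: measurable_funM; first exact: measurable_cst.
  by apply: measurable_funD; exact: me.
apply: (mgf_centered_le (fun w => X w * Y w) H) => //.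
- exact: measurable_funM.
- move=> w; rewrite /H normrM.
  have := expR_ge1Dx (X w ^+ 2 / 4); have := expR_ge1Dx (Y w ^+ 2 / 4).
  rewrite -[X w ^+ 2]real_normK ?num_real // -[Y w ^+ 2]real_normK ?num_real //.
  move: `|X w| `|Y w| => x y; have := sqr_ge0 (x - y); lra.
- move=> w; rewrite /H normrM.
  rewrite -[X w ^+ 2]real_normK ?num_real // -[Y w ^+ 2]real_normK ?num_real //.
  move: `|X w| `|Y w| => x y.
  have h z : expR (z ^+ 2 / 4) = expR (z ^+ 2 / 8) ^+ 2 :> R.
    by rewrite -expRM_natl; congr expR; field.
  have := sqr_ge0 (expR (x ^+ 2 / 8) - expR (y ^+ 2 / 8)).
  have : expR (x * y / 4) <= expR (x ^+ 2 / 8) * expR (y ^+ 2 / 8).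
    by rewrite -expRD ler_expR; have := sqr_ge0 (x - y); lra.
  rewrite !h; lra.
rewrite /H; under eq_integral => w _ do rewrite EFinM EFinD.
have mEX : measurable_fun setT (fun w => (expR (X w ^+ 2 / 4))%:E).
  by apply/measurable_EFinP; exact: me.
have mEY : measurable_fun setT (fun w => (expR (Y w ^+ 2 / 4))%:E).
  by apply/measurable_EFinP; exact: me.
rewrite ge0_integralZl_EFin //; last 2 first.
- by move=> w _; rewrite adde_ge0 // lee_fin expR_ge0.
- exact: emeasurable_funD.
rewrite ge0_integralD //.
apply: (@le_trans _ _ (2^-1%:E * (2%:E + 2%:E))%E).
  by rewrite lee_wpmul2l ?lee_fin // leeD.
by rewrite -EFinD -EFinM lee_fin; lra.
Qed.

End subexponential.

(** * Sample covariance deviations *)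

Section setting.
Context {R : realType} {d : measure_display} {T : measurableType d}.
Context (P : probability T R).

Lemma integral_mul_covariance (X Y : {RV P >-> R}) (s : R) :
  ('E_P[X] = 0)%E -> ('E_P[Y] = 0)%E -> covariance P X Y = s%:E ->
  (\int[P]_w (X w * Y w)%:E = s%:E)%E.
Proof.
move=> EX EY <-; rewrite covariance.unlock EX EY unlock.
apply: eq_integral => w _; congr EFin.
by rewrite -[in LHS](subr0 (X w)) -[in LHS](subr0 (Y w)).
Qed.

Lemma sigma_vec_sub (p : nat) (Y : 'I_p -> {RV P >-> R}) (i j : 'I_p)
    (g : R -> R) (x : R) :
  measurable_fun setT g ->
  sigma_vec Y [set w | x <= g (Y i w * Y j w)].
Proof.
move=> mg; set G := \bigcup_(k in [set: 'I_p]) preimage_set_system setT (Y k) measurable.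
(* The coordinates are viewed on [T] equipped with the generated sigma-algebra, so that ordinary
   measurability of a composite yields membership in [sigma_vec Y]. *)
pose y k : g_sigma_algebraType G -> R := Y k.
have my k : measurable_fun setT (y k).
  move=> _ B mB; apply: sub_sigma_algebra.
  by exists k => //; exists B.
have mf : measurable_fun setT (fun w => g (y i w * y j w)).
  by apply: measurableT_comp => //; exact: measurable_funM.
have -> : [set w | x <= g (Y i w * Y j w)] =
    setT `&` (fun w => g (Y i w * Y j w)) @^-1` `[x, +oo[.
  by apply/seteqP; split => w /=; rewrite in_itv /= andbT // => -[].
exact: (mf measurableT _ (measurable_itv _)).
Qed.

Context (m n p : nat) (X : 'I_m -> 'I_n -> 'I_p -> {RV P >-> R}).
Context (Sigma : 'I_m -> 'M[R]_p).

Definition dev (i j : 'I_p) (l : 'I_m) (w : T) : R :=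
  hatSigma (X l) i j w - Sigma l i j.

Lemma measurable_dev i j l : measurable_fun setT (dev i j l).
Proof.
apply: measurable_funB; last exact: measurable_cst.
apply: measurable_funM; first exact: measurable_cst.
apply: measurable_sum => k.
by apply: measurable_funM.
Qed.

(** The factor [n] cancels the normalisation in [hatSigma], so the joint exponential is a product
    over pairs [(l, k)] of functions of one vector each. The admissible radius lies below [8^-1], as
    the one-vector bound requires. *)
Lemma mgf_dev_le (i j : 'I_p) (th : 'I_m -> R) :
  thm4_setting X Sigma -> (forall l, `|th l| <= (2 * (256 * expR 2))^-1) ->
  (\int[P]_w (expR (\sum_l th l * (n%:R * dev i j l w)))%:E <=
   (expR (256 * expR 2 * n%:R * \sum_l th l ^+ 2))%:E)%E.
Proof.
move=> [_ [n0 [_ [ind [EX [cov psi]]]]]] th8.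
have th8' l : `|th l| <= 8^-1.
  apply: le_trans (th8 l) _; rewrite lef_pV2 ?posrE ?mulr_gt0 ?expR_gt0 //.
  have := expR_ge1Dx (2 : R); lra.
pose I := ('I_m * 'I_n)%type.
pose f (a : I) w := expR (th a.1 * (X a.1 a.2 i w * X a.1 a.2 j w - Sigma a.1 i j)).
pose c (a : I) := expR (256 * expR 2 * th a.1 ^+ 2).
have mexp (a : I) : measurable_fun setT (fun z : R => expR (th a.1 * (z - Sigma a.1 i j))).
  apply: measurableT_comp; first exact: measurable_expR.
  apply: measurable_funM; first exact: measurable_cst.
  by apply: measurable_funB => //; exact: measurable_cst.
have fE w : expR (\sum_l th l * (n%:R * dev i j l w)) = \prod_a f a w.
  rewrite -expR_sum -(pair_bigA _ (fun l k => th l * (X l k i w * X l k j w - Sigma l i j))) /=.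
  congr expR; apply: eq_bigr => l _; rewrite -mulr_sumr; congr (_ * _).
  rewrite /dev /hatSigma mulrBr mulrA divff ?pnatr_eq0 -?lt0n // mul1r.
  by rewrite sumrB sumr_const card_ord mulr_natl.
have cE : expR (256 * expR 2 * n%:R * \sum_l th l ^+ 2) = \prod_a c a.
  rewrite -expR_sum -(pair_bigA _ (fun l (k : 'I_n) => 256 * expR 2 * th l ^+ 2)) /=.
  congr expR; rewrite mulr_sumr; apply: eq_bigr => l _.
  by rewrite sumr_const card_ord -[RHS]mulr_natr; ring.
rewrite cE; under eq_integral => w _ do rewrite fE.
apply: integral_prod_le.
- move=> a; apply: (measurableT_comp (mexp a)).
  exact: measurable_funM.
- by move=> a w; exact: expR_ge0.
- move=> x; apply: ind => a.
  exact: (sigma_vec_sub _ (X a.1 a.2) i j _ (x a) (mexp a)).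
- move=> a; apply: mgf_mul_le => //.
  exact: (integral_mul_covariance _ _ _ (EX _ _ _) (EX _ _ _) (cov _ _ _ _)).
Qed.

Lemma sq_dev_tail (i j : 'I_p) (K t : R) : K = 256 * expR 2 ->
  thm4_setting X Sigma -> 0 < t ->
  (P [set w | (t + (2 + 192 * (8 * K) ^+ 4) * (m%:R / n%:R) <=
               sq_dev X Sigma i j w)%R]
   <= (3 * expR (- ((8 * K)^-1 / (12 * K) ^+ 2 * (n%:R * rate t))))%:E)%E.
Proof.
move=> KE XS t0; have [m0 [n0 _]] := XS.
have K1 : 1 <= K by rewrite KE; have := expR_ge1Dx (2 : R); lra.
apply: (sum_sq_tail P m n (dev i j) K) => //; first exact: measurable_dev.
by move=> th; rewrite KE => th8; exact: mgf_dev_le.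
Qed.

Lemma measurable_sq_dev_ge (i j : 'I_p) (x : R) :
  measurable [set w | x <= sq_dev X Sigma i j w].
Proof. by apply: measurable_sum_sq_ge => l; exact: measurable_dev. Qed.

End setting.

(** * Anti-concentration *)

Section anticoncentration.
Context {R : realType}.

Lemma min_rate (n : nat) (t : R) :
  Num.min (n%:R * t) (n%:R * Num.sqrt t) = n%:R * rate t.
Proof. by rewrite /rate minr_pMr. Qed.

(** This inverts the rate at confidence level [nu]. The linear branch uses [n y >= 1 + nu], the root
    branch [n^2 y >= 1 + nu + nu^2 >= ((1 + nu) / 2)^2]. *)
Lemma rate_quad_ge (n : nat) (nu : R) : (0 < n)%N -> 0 <= nu ->
  (1 + nu) / 2 <= n%:R * rate ((1 + nu) / n%:R + nu ^+ 2 / n%:R ^+ 2).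
Proof.
move=> n0 nu0; have n1 : 1 <= n%:R :> R by rewrite ler1n.
have n0' : 0 < n%:R :> R by lra.
set y := (1 + nu) / n%:R + _.
have y0 : 0 <= y by rewrite addr_ge0 // divr_ge0 ?sqr_ge0 //; lra.
rewrite -ler_pdivrMl // le_min; apply/andP; split.
  have -> : y = n%:R^-1 * (1 + nu + nu ^+ 2 / n%:R).
    by rewrite /y; field; rewrite gt_eqF.
  rewrite ler_wpM2l ?invr_ge0 //.
  have : 0 <= nu ^+ 2 / n%:R by rewrite divr_ge0 ?sqr_ge0.
  lra.
have h0 : 0 <= n%:R^-1 * ((1 + nu) / 2) by rewrite mulr_ge0 ?invr_ge0 //; lra.
rewrite -[leLHS]ger0_norm // -sqrtr_sqr ler_wsqrtr //.
have -> : y = (n%:R^-1) ^+ 2 * (n%:R * (1 + nu) + nu ^+ 2).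
  by rewrite /y; field; rewrite gt_eqF.
rewrite exprMn ler_wpM2l ?sqr_ge0 //.
have := ler_wpM2r (_ : 0 <= 1 + nu) n1; rewrite mul1r => /(_ ltac:(lra)).
nra.
Qed.

Context {d : measure_display} {T : measurableType d} (P : probability T R).
Context (m n : nat) (m0 : (0 < m)%N) (n0 : (0 < n)%N).
Context (D : 'I_m -> T -> R) (mD : forall l, measurable_fun setT (D l)).

Let mabs l (x : R) : measurable [set w | x <= `|D l w|].
Proof.
rewrite [X in measurable X](_ : _ = setT `&` (fun w => `|D l w|) @^-1` `[x, +oo[).
  by apply: measurableT_comp => //; exact: measurable_itv.
by apply/seteqP; split => w /=; rewrite in_itv /= andbT // => -[].
Qed.

(* Reverse Markov for the number of [l] with [1 <= n%:R * D l w ^+ 2]. *)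
Lemma sum_sq_ge_cst (p1 : R) : 0 < p1 ->
  (forall l, (p1%:E <= P [set w | ((Num.sqrt n%:R)^-1 <= `|D l w|)%R])%E) ->
  ((p1 / 2)%:E <= P [set w | (p1 / 2 * (m%:R / n%:R) <= \sum_l D l w ^+ 2)%R])%E.
Proof.
move=> p0 pA; pose A l := [set w | (Num.sqrt n%:R)^-1 <= `|D l w|].
have m0' : 0 < m%:R :> R by rewrite ltr0n.
have n0' : 0 < n%:R :> R by rewrite ltr0n.
set B := [set w | _]; have mB : measurable B by exact: measurable_sum_sq_ge.
pose b := fine (P B); have bE : P B = b%:E by rewrite fineK // fin_num_measure.
have mA l : measurable (A l) by exact: mabs.
have mi C : measurable C -> measurable_fun setT (EFin \o (\1_C : T -> R)).
  by move=> mC; apply/measurable_EFinP; exact: measurable_indic.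
(* Off [B], the count is at most [n] times the sum of squares, hence below [p1 / 2 * m]; on [B] it
   is at most [m]. Comparing means gives [p1 <= p1 / 2 + b]. *)
have : ((p1 * m%:R)%:E <= (p1 / 2 * m%:R)%:E + m%:R%:E * b%:E)%E.
  apply: (@le_trans _ _ (\int[P]_w (\sum_l (\1_(A l) w : R)%:E))%E).
    rewrite ge0_integral_sum //; last by move=> l; exact: mi.
    rewrite mulr_natr -[X in _ *+ X](card_ord m) -sumr_const -sumEFin.
    apply: lee_sum => l _; rewrite integral_indic ?setIT //; exact: pA.
  have -> : ((p1 / 2 * m%:R)%:E + m%:R%:E * b%:E =
      \int[P]_w ((p1 / 2 * m%:R)%:E + m%:R%:E * (\1_B w)%:E))%E.
    rewrite ge0_integralD //; last 2 first.
    - by move=> w _; rewrite lee_fin mulr_ge0 // divr_ge0 // ltW.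
    - by apply: measurable_funeM; exact: mi.
    rewrite integral_probability_cst ge0_integralZl_EFin //; last exact: mi.
    rewrite integral_indic ?setIT //; congr (_ + _ * _)%E; exact: esym bE.
  apply: ge0_le_integral => //.
  - by move=> w _; rewrite sumEFin lee_fin sumr_ge0.
  - by apply: emeasurable_sum => l; exact: mi.
  - by apply: emeasurable_funD => //; apply: measurable_funeM; exact: mi.
  move=> w _; rewrite sumEFin -EFinM -EFinD lee_fin.
  have [wB|wB] := boolP (w \in B).
    rewrite indicE wB mulr1 -[leLHS]add0r lerD //.
      by rewrite mulr_ge0 // divr_ge0 // ltW.
    rewrite -[X in X%:R](card_ord m) -sumr_const; apply: ler_sum => l _.
    by rewrite indicE lern1 leq_b1.
  rewrite indicE (negbTE wB) mulr0 addr0.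
  have {}wB : \sum_l D l w ^+ 2 < p1 / 2 * (m%:R / n%:R).
    by rewrite ltNge; apply/negP => h; move/negP: wB; apply; rewrite inE.
  apply: (@le_trans _ _ (n%:R * \sum_l D l w ^+ 2)); last first.
    by move: (ltW wB); rewrite mulrA ler_pdivlMr // [_ * n%:R]mulrC.
  rewrite mulr_sumr; apply: ler_sum => l _; rewrite indicE.
  have [/set_mem wA|_] := boolP (w \in A l); last by rewrite mulr_ge0 // sqr_ge0.
  rewrite -[D l w ^+ 2]real_normK ?num_real // mulrC -ler_pdivrMr // mul1r.
  have -> : n%:R^-1 = (Num.sqrt n%:R)^-1 ^+ 2 :> R by rewrite exprVn sqr_sqrtr.
  by rewrite lerXn2r ?nnegrE ?invr_ge0 ?sqrtr_ge0.
rewrite bE -EFinM -EFinD !lee_fin => h.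
by rewrite -(ler_pM2r m0'); lra.
Qed.

End anticoncentration.

(** * Upper tail, high-probability form and lower bound *)

Theorem theorem4 (R : realType) :
  (* upper tail bound with absolute constants C1, C2 *)
  (exists C1 C2 : R, 0 < C1 /\ 0 < C2 /\
    forall (d : measure_display) (T : measurableType d) (P : probability T R)
      (m n p : nat) (X : 'I_m -> 'I_n -> 'I_p -> {RV P >-> R})
      (Sigma : 'I_m -> 'M[R]_p),
    thm4_setting X Sigma ->
    forall (i j : 'I_p) (t : R), 0 < t ->
      (P [set w | (t + C1 * (m%:R / n%:R) <= sq_dev X Sigma i j w)%R]
       <= (4 * expR (- C2 * Num.min (n%:R ^+ 2 * t ^+ 2 / m%:R)
                              (Num.min (n%:R * t) (n%:R * Num.sqrt t))))%:E)%E)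
  /\
  (* equivalent high-probability form with an absolute constant C *)
  (exists C : R, 0 < C /\
    forall (d : measure_display) (T : measurableType d) (P : probability T R)
      (m n p : nat) (X : 'I_m -> 'I_n -> 'I_p -> {RV P >-> R})
      (Sigma : 'I_m -> 'M[R]_p),
    thm4_setting X Sigma ->
    forall (i j : 'I_p) (nu : R), 0 < nu ->
      ((1 - expR (- nu))%:E
       <= P [set w | (sq_dev X Sigma i j w
                     <= C * ((m%:R + Num.sqrt (m%:R * nu) + nu) / n%:R
                             + nu ^+ 2 / n%:R ^+ 2))%R])%E)
  /\
  (* matching lower bound under the anti-concentration assumption *)
  (forall c : R, 0 < c ->
    exists C3 C4 C5 : R, 0 < C3 /\ 0 < C4 /\ 0 < C5 /\
    forall (d : measure_display) (T : measurableType d) (P : probability T R)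
      (m n p : nat) (X : 'I_m -> 'I_n -> 'I_p -> {RV P >-> R})
      (Sigma : 'I_m -> 'M[R]_p),
    thm4_setting X Sigma ->
    forall (i j : 'I_p),
    (forall (l : 'I_m) (t : R), 0 < t ->
       ((expR (- c * Num.min (n%:R * t) (n%:R * t ^+ 2)))%:E
        <= P [set w | (t <= `|hatSigma (X l) i j w - Sigma l i j|)%R])%E) ->
    forall t : R, 0 < t ->
      ((C4^-1 * expR (- C5 * Num.min (n%:R ^+ 2 * t ^+ 2 / m%:R)
                              (Num.min (n%:R * t) (n%:R * Num.sqrt t))))%:E
       <= P [set w | (t + C3 * (m%:R / n%:R) <= sq_dev X Sigma i j w)%R])%E).
Proof.
pose K : R := 256 * expR 2.
pose C2 : R := (8 * K)^-1 / (12 * K) ^+ 2.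
pose C1 : R := 2 + 192 * (8 * K) ^+ 4.
have K1 : 1 <= K by rewrite /K; have := expR_ge1Dx (2 : R); lra.
have K0 : 0 < K by lra.
have C20 : 0 < C2 by rewrite divr_gt0 ?invr_gt0 ?exprn_gt0 ?mulr_gt0.
have C10 : 0 < C1.
  by rewrite addr_gt0 // mulr_gt0 // exprn_gt0 // mulr_gt0.
split; [|split].
- exists C1, C2; split=> //; split=> // d T P m n p X Sigma XS i j t t0.
  apply: le_trans (sq_dev_tail P m n p X Sigma i j K t erefl XS t0) _.
  rewrite lee_fin ler_pM ?expR_ge0 //; first lra.
  rewrite ler_expR mulNr lerN2 ler_pM2l //.
  by rewrite min_rate ge_min lexx orbT.
(* Since [C2 * q = C2 + 4], the exponent at [t] is at least [2 * (1 + nu)], which yields [nu] and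
   still leaves [expR 2] to absorb the prefactor 3. *)
- pose q : R := 1 + 4 / C2.
  have q1 : 1 <= q by rewrite lerDl divr_ge0 // ltW.
  have q20 : 0 < q ^+ 2 by rewrite exprn_gt0 //; lra.
  exists (q ^+ 2 + C1); split; first by rewrite addr_gt0.
  move=> d T P m n p X Sigma XS i j nu nu0; have [m0 [n0 _]] := XS.
  have n0' : 0 < n%:R :> R by rewrite ltr0n.
  have m1 : 1 <= m%:R :> R by rewrite ler1n.
  set y := (m%:R + _ + nu) / n%:R + _.
  (* This choice turns the threshold [t + C1 * (m / n)] into exactly [(q ^+ 2 + C1) * y]; as [y]
     dominates both [m / n] and [z], at least [q ^+ 2 * z] is left for [t]. *)
  pose t := (q ^+ 2 + C1) * y - C1 * (m%:R / n%:R).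
  pose z := (1 + nu) / n%:R + nu ^+ 2 / n%:R ^+ 2.
  have z0 : 0 < z.
    apply: ltr_wpDr; first by rewrite divr_ge0 ?sqr_ge0.
    by rewrite divr_gt0 //; lra.
  have zy : z <= y.
    rewrite lerD2r ler_pM2r ?invr_gt0 // lerD2r.
    by have := sqrtr_ge0 (m%:R * nu); lra.
  have my : m%:R / n%:R <= y.
    rewrite /y -[leLHS]addr0; apply: lerD; last by rewrite divr_ge0 ?sqr_ge0.
    by rewrite ler_pM2r ?invr_gt0 //; have := sqrtr_ge0 (m%:R * nu); lra.
  have zt : q ^+ 2 * z <= t.
    have := ler_wpM2l (ltW C10) my; have := ler_wpM2l (ltW q20) zy.
    by rewrite /t; lra.
  have t0 : 0 < t by apply: lt_le_trans zt; exact: mulr_gt0.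
  have rt : q * ((1 + nu) / 2) <= n%:R * rate t.
    apply: (@le_trans _ _ (q * (n%:R * rate z))).
      by rewrite ler_wpM2l ?rate_quad_ge //; lra.
    rewrite mulrCA ler_wpM2l //; apply: le_trans (le_rate _ _ zt).
    by rewrite rate_scale // ltW.
  have thrE : t + C1 * (m%:R / n%:R) = (q ^+ 2 + C1) * y by rewrite /t subrK.
  set B := [set w | _].
  pose A := [set w | (q ^+ 2 + C1) * y <= sq_dev X Sigma i j w].
  have mA : measurable A by exact: measurable_sq_dev_ge.
  have mB : measurable B.
    rewrite (_ : B = setT `&` (sq_dev X Sigma i j) @^-1` `]-oo, (q ^+ 2 + C1) * y]).
      have mSq : measurable_fun setT (sq_dev X Sigma i j).
        by apply: measurable_sum_sq => l; exact: (measurable_dev P m n p X Sigma i j).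
      by apply: mSq => //; exact: measurable_itv.
    by apply/seteqP; split => w /=; rewrite in_itv //= => -[].
  apply: (@le_trans _ _ (P (~` A))); last first.
    apply: le_measure; rewrite ?inE //; first exact: measurableC.
    by move=> w /negP; rewrite -ltNge => /ltW.
  rewrite probability_setC // EFinB leeB //.
  have := sq_dev_tail P m n p X Sigma i j K t erefl XS t0.
  rewrite -/C1 -/C2 thrE => /le_trans; apply; rewrite lee_fin.
  have e2 : 3 <= expR 2 :> R by have := expR_ge1Dx (2 : R); lra.
  apply: (@le_trans _ _ (expR 2 * expR (- (C2 * (n%:R * rate t))))).
    by rewrite ler_wpM2r ?expR_ge0.
  rewrite -expRD ler_expR.
  have := ler_wpM2l (ltW C20) rt.
  have -> : C2 * (q * ((1 + nu) / 2)) = (C2 + 4) * ((1 + nu) / 2).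
    by rewrite /q; field; rewrite gt_eqF.
  have : 0 <= C2 * ((1 + nu) / 2) by rewrite mulr_ge0 // ?ltW //; lra.
  lra.
move=> c c0; pose p1 := expR (- c); have p10 : 0 < p1 by exact: expR_gt0.
have p11 : p1 <= 1 by rewrite -expR0 ler_expR; lra.
(* The level [p1 / 2 * (m / n)] of the reverse Markov bound splits into two shares [del * (m / n)],
   one for [t] and one for the shift. *)
pose del := p1 / 4; have del0 : 0 < del by rewrite divr_gt0.
(* [C4^-1 = p1 / 2] is the reverse Markov probability. In [C5], the factor 2 pays for doubling [t]
   and [del^-1] for [del * N <= mn]. *)
exists del, (2 / p1), (2 * c / del); split=> //; split; first by rewrite divr_gt0.
split; first by rewrite divr_gt0 // mulr_gt0.
move=> d T P m n p X Sigma XS i j lower t t0; have [m0 [n0 _]] := XS.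
have n0' : 0 < n%:R :> R by rewrite ltr0n.
have m0' : 0 < m%:R :> R by rewrite ltr0n.
rewrite min_rate invf_div.
set N := n%:R * rate t; have N0 : 0 <= N by rewrite mulr_ge0 // rate_ge0 // ltW.
set mn := Num.min _ N.
have C50 : 0 <= 2 * c / del by rewrite divr_ge0 ?mulr_ge0 // ltW.
have mdev := measurable_dev P m n p X Sigma i j.
have mS x := measurable_sq_dev_ge P m n p X Sigma i j x.
have [nt|nt] := lerP (n%:R * t) (del * m%:R).
  apply: (@le_trans _ _ (p1 / 2)%:E).
    rewrite lee_fin ler_piMr ?divr_ge0 ?(ltW p10) // -[leRHS]expR0 ler_expR.
    rewrite mulNr oppr_le0 mulr_ge0 // /mn le_min N0 andbT.
    by rewrite divr_ge0 // mulr_ge0 ?sqr_ge0.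
  apply: le_trans (sum_sq_ge_cst P m n m0 n0 _ mdev p1 p10 _) _.
    move=> l; have sn0 : 0 < Num.sqrt n%:R :> R by rewrite sqrtr_gt0.
    have isn : 0 < (Num.sqrt n%:R)^-1 :> R by rewrite invr_gt0.
    (* At deviation [1 / sqrt n] the quadratic branch equals 1, so the assumed probability is at
       least [p1]. *)
    apply: le_trans (lower l _ isn); rewrite lee_fin ler_expR mulNr lerN2.
    rewrite -[leRHS]mulr1 ler_pM2l // ge_min exprVn sqr_sqrtr // divff ?gt_eqF //.
    by rewrite lexx orbT.
  apply: le_measure; rewrite ?inE; [exact: mS|exact: mS|].
  move=> w /=; apply: le_trans.
  have -> : p1 / 2 * (m%:R / n%:R) = del * m%:R / n%:R + del * (m%:R / n%:R).
    by rewrite /del; field; rewrite gt_eqF.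
  by rewrite lerD2r ler_pdivlMr // mulrC.
(* When [n t > del m], the term [n^2 t^2 / m] is at least [del n t], so the three-term minimum is
   comparable to [N]. *)
have mnN : del * N <= mn.
  rewrite /mn le_min; apply/andP; split; last first.
    by rewrite ler_piMl // /del; lra.
  apply: (@le_trans _ _ (del * (n%:R * t))).
    by rewrite ler_pM2l // ler_pM2l // ge_min lexx.
  rewrite ler_pdivlMr // mulrAC -exprMn expr2.
  by rewrite ler_pM2r ?mulr_gt0 // ltW.
pose l0 := Ordinal m0.
have s0 : 0 < Num.sqrt (2 * t) by rewrite sqrtr_gt0 mulr_gt0.
(* One coordinate suffices here: its square reaches [2 t], which covers [t] and the shift because
   [del * (m / n) < t]. *)
apply: (@le_trans _ _ (P [set w | (Num.sqrt (2 * t) <= `|dev P m n p X Sigma i j l0 w|)%R])).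
  apply: le_trans (lower l0 _ s0); rewrite lee_fin.
  apply: (@le_trans _ _ (1 * expR (- (2 * c / del) * mn))).
    by rewrite ler_wpM2r ?expR_ge0 //; lra.
  rewrite mul1r ler_expR !mulNr lerN2 sqr_sqrtr ?mulr_ge0 ?(ltW t0) //.
  rewrite minC min_rate.
  have r2 : n%:R * rate (2 * t) <= 2 * N.
    by rewrite mulrCA ler_pM2l // rate_double // ltW.
  apply: (@le_trans _ _ (2 * c / del * (del * N))); last by rewrite ler_wpM2l.
  have -> : 2 * c / del * (del * N) = c * (2 * N) by field; rewrite gt_eqF.
  by rewrite ler_pM2l.
apply: le_measure; rewrite ?inE; [|exact: mS|].
  rewrite [X in measurable X](_ : _ = setT `&` (fun w => `|dev P m n p X Sigma i j l0 w|) @^-1` `[Num.sqrt (2 * t), +oo[).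
    by apply: measurableT_comp => //; exact: measurable_itv.
  by apply/seteqP; split => w /=; rewrite in_itv /= andbT // => -[].
move=> w /= dw.
rewrite /sq_dev (bigD1 l0) //= -[leLHS]addr0; apply: lerD; last first.
  by apply: sumr_ge0 => l _; exact: sqr_ge0.
apply: (@le_trans _ _ (2 * t)).
  have : del * (m%:R / n%:R) <= t.
    by rewrite mulrA ler_pdivrMr // mulrC [_ * n%:R]mulrC ltW // [_ * del]mulrC.
  lra.
rewrite -[leLHS]sqr_sqrtr ?mulr_ge0 ?(ltW t0) //.
rewrite -[leRHS]real_normK ?num_real // lerXn2r ?nnegrE ?sqrtr_ge0 //.
Qed.
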